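(* Let $\Theta$ be a proper real $n\times m$ matrix with $R(\Theta)\leqslant n+K(\Theta)-1$. Then the entries $\theta^i_j$ of $\Theta$ satisfy a nontrivial algebraic relation (a nonzero polynomial with integer coefficients in the $mn$ entries vanishes at them) of degree at most $\min(m,\,R(\Theta)-K(\Theta)+1)$.
   Context: $\Theta=(\theta^i_j)$, $1\leqslant j\leqslant n$, $1\leqslant i\leqslant m$, real; $L_j(\mathbf x)=\sum_{i}\theta^i_jx_i$ for $\mathbf x\in\mathbb Z^m$; $\|\cdot\|$ = distance to nearest integer; $M(\mathbf x)=\max_i|x_i|$, $\zeta(\mathbf x)=\max_j\|L_j(\mathbf x)\|$. A nonzero $\mathbf x\in\mathbb Z^m$ is a best approximation if $\zeta(\mathbf x)\leqslant\zeta(\mathbf x')$ for all nonzero $\mathbf x'\in\mathbb Z^m$ with $M(\mathbf x')\leqslant M(\mathbf x)$; their values give sequences $M_1<M_2<\cdots$, $\zeta_1>\zeta_2>\cdots$, with corresponding best approximations $\mathbf x_\nu$ and extended vectors $\mathbf z_\nu=(\mathbf x_\nu,y_{1,\nu},\dots,y_{n,\nu})\in\mathbb Z^{m+n}$, $y_{j,\nu}\in\mathbb Z$ with $|L_j(\mathbf x_\nu)+y_{j,\nu}|=\|L_j(\mathbf x_\nu)\|$. $\Theta$ is proper if these sequences are infinite and $\mathbf x_\nu$ is unique up to sign for all large $\nu$. For proper $\Theta$: $R(\Theta)$ is the least $r$ such that some lattice $\Lambda\subseteq\mathbb Z^{m+n}$ with $\dim\operatorname{span}\Lambda=r$ contains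 $\mathbf z_\nu$ for all $\nu\geqslant\nu_0$ (some $\nu_0$); $\pi_\Theta$ is the span of such a lattice (equivalently, the span of $\{\mathbf z_\nu:\nu\geqslant\nu_0\}$ for $\nu_0$ large). $\mathcal L(\Theta)=\{(\mathbf x,\mathbf y)\in\mathbb R^{m+n}: L_j(\mathbf x)+y_j=0,\ 1\leqslant j\leqslant n\}$ (dimension $m$), and $K(\Theta)=\dim(\pi_\Theta\cap\mathcal L(\Theta))$. *)

(* Defs.v *)
(* MathComp world, with realType and sets from MathComp-Analysis. *)
From mathcomp Require Import all_boot all_order all_algebra.
From mathcomp Require Import boolp classical_sets reals.
From mathcomp Require Import mpoly.

Set Implicit Arguments.
Unset Strict Implicit.
Unset Printing Implicit Defensive.

Import Order.TTheory GRing.Theory Num.Theory.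
Local Open Scope classical_set_scope.
Local Open Scope ring_scope.

(* A system of n linear forms in m variables is a matrix Theta with n rows
   and m columns; the entry theta^i_j is Theta j i.  Points of Z^m, Z^n and
   Z^(m+n) are row vectors. *)

Definition dist_int (R : realType) (t : R) : R :=
  inf [set `|t - k%:~R| | k in [set: int]].

Definition lform (R : realType) (m n : nat) (Theta : 'M[R]_(n, m))
    (j : 'I_n) (x : 'rV[int]_m) : R :=
  \sum_(i < m) Theta j i * (x 0 i)%:~R.

Definition Mnorm (m : nat) (x : 'rV[int]_m) : nat := (\max_(i < m) absz (x 0%R i))%N.

Definition zeta (R : realType) (m n : nat) (Theta : 'M[R]_(n, m))
    (x : 'rV[int]_m) : R :=
  \big[Num.max/0]_(j < n) dist_int (lform Theta j x).

Definition best_approx (R : realType) (m n : nat) (Theta : 'M[R]_(n, m))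
    (x : 'rV[int]_m) : Prop :=
  x != 0 /\
  forall x' : 'rV[int]_m, x' != 0 -> (Mnorm x' <= Mnorm x)%N ->
    zeta Theta x <= zeta Theta x'.

(* x 0, x 1, ... is an infinite sequence of best approximations realizing
   M_1 < M_2 < ... and zeta_1 > zeta_2 > ... .  The last clause says that the
   zeta_nu are all the values of zeta at best approximations.  A value may
   recur at best approximations of different heights (for instance the value 0
   does at the multiples of an integer zero), and such recurrences cannot be
   listed in a strictly decreasing sequence; M_nu is the smallest height at
   which zeta_nu occurs. *)
Definition best_approx_seq (R : realType) (m n : nat) (Theta : 'M[R]_(n, m))
    (x : nat -> 'rV[int]_m) : Prop :=
  [/\ forall nu, best_approx Theta (x nu),
      forall nu, (Mnorm (x nu) < Mnorm (x nu.+1))%N,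
      forall nu, zeta Theta (x nu.+1) < zeta Theta (x nu)
    & forall w, best_approx Theta w ->
        exists nu, zeta Theta w = zeta Theta (x nu) /\
                   (Mnorm (x nu) <= Mnorm w)%N].

Definition proper_matrix (R : realType) (m n : nat) (Theta : 'M[R]_(n, m)) : Prop :=
  exists x : nat -> 'rV[int]_m,
    best_approx_seq Theta x /\
    exists nu0 : nat, forall nu, (nu0 <= nu)%N ->
      forall w, best_approx Theta w ->
        Mnorm w = Mnorm (x nu) -> zeta Theta w = zeta Theta (x nu) ->
        w = x nu \/ w = - x nu.

Definition extended_seq (R : realType) (m n : nat) (Theta : 'M[R]_(n, m))
    (z : nat -> 'rV[int]_(m + n)) : Prop :=
  best_approx_seq Theta (fun nu => lsubmx (z nu)) /\
  forall nu (j : 'I_n),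
    `|lform Theta j (lsubmx (z nu)) + (rsubmx (z nu) 0 j)%:~R| =
    dist_int (lform Theta j (lsubmx (z nu))).

(* For proper Theta the choice of the sequence is immaterial: z nu is
   determined up to sign as soon as nu is large (in particular
   zeta_nu < 1/2), and Lambda is stable under opposite. *)
Definition contains_tail (R : realType) (m n : nat) (Theta : 'M[R]_(n, m))
    (Lambda : zmodClosed 'rV[int]_(m + n)) : Prop :=
  exists z : nat -> 'rV[int]_(m + n),
    extended_seq Theta z /\
    exists nu0 : nat, forall nu, (nu0 <= nu)%N -> z nu \in Lambda.

Definition is_span (R : realType) (N : nat) (Lambda : zmodClosed 'rV[int]_N)
    (V : {vspace 'rV[R]_N}) : Prop :=
  (forall v, v \in Lambda -> map_mx intr v \in V) /\
  (forall W : {vspace 'rV[R]_N},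
     (forall v, v \in Lambda -> map_mx intr v \in W) -> (V <= W)%VS).

Definition tail_span (R : realType) (m n : nat) (Theta : 'M[R]_(n, m))
    (V : {vspace 'rV[R]_(m + n)}) : Prop :=
  exists Lambda : zmodClosed 'rV[int]_(m + n),
    contains_tail Theta Lambda /\ is_span Lambda V.

(* R(Theta).  When Theta is proper the minimum exists, Lambda = Z^(m+n)
   being admissible; the default value 0 is only used otherwise. *)
Definition Rdim (R : realType) (m n : nat) (Theta : 'M[R]_(n, m)) : nat :=
  xget 0%N [set r : nat |
    (exists V, tail_span Theta V /\ \dim V = r) /\
    (forall V, tail_span Theta V -> (r <= \dim V)%N)].

(* pi_Theta.  For proper Theta there is exactly one such subspace: if two
   lattices are admissible so is their intersection, hence minimality of the
   dimension forces their spans to coincide. *)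
Definition pi_space (R : realType) (m n : nat) (Theta : 'M[R]_(n, m))
    : {vspace 'rV[R]_(m + n)} :=
  xget 0%VS [set V | tail_span Theta V /\ \dim V = Rdim Theta].

(* The kernel of (x, y) |-> x *m Theta^T + y, whose j-th coordinate is
   L_j(x) + y_j. *)
Definition Lspace (R : realType) (m n : nat) (Theta : 'M[R]_(n, m))
    : {vspace 'rV[R]_(m + n)} :=
  lker (linfun (mulmxr (col_mx Theta^T 1%:M) : 'rV[R]_(m + n) -> 'rV[R]_n)).

Definition Kdim (R : realType) (m n : nat) (Theta : 'M[R]_(n, m)) : nat :=
  \dim (pi_space Theta :&: Lspace Theta)%VS.

(* A nonzero integer polynomial in the n * m entries, of total degree at most
   d, vanishing at Theta.  The entry Theta j i is substituted for the variable
   of index mxvec_index j i; msize is the total degree plus one. *)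
Definition algebraic_relation (R : realType) (m n : nat)
    (Theta : 'M[R]_(n, m)) (d : nat) : Prop :=
  exists p : {mpoly int[n * m]},
    [/\ p != 0,
        (msize p <= d.+1)%N
      & mmap intr (fun k => mxvec Theta 0 k) p = 0 :> R].

(* Main.v *)
(* Write V for pi_Theta, f for the map z |-> (L_j(x) + y_j)_j, R = dim V and
   K = dim (V :&: ker f).  First K > 0: otherwise f is injective on V, and since
   f is bounded along the best approximations z_nu, which eventually lie in V,
   these would be bounded, whereas their heights tend to infinity.

   Put s = R - K + 1; then s <= R and s <= n.  Choose s linearly independent
   integer vectors in V, as the rows of a matrix B = (B1 | B2).  The matrix
   B1 * Theta^T + B2 of values of f has rank at most dim f(V) = R - K < s.  For
   a generic matrix X, on the contrary, B1 * X^T + B2 has rank s, so for a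
   suitable integer matrix P the polynomial det ((B1 * X^T + B2) * P) in the
   entries of X is nonzero, and it vanishes at Theta.  After Gaussian
   elimination on B1 only rank B1 <= m rows of this determinant involve X (in
   degree one), so its degree is at most min(m, s). *)
From HB Require Import structures.
Require Import Defs.
From mathcomp Require Import all_boot all_order all_algebra.
From mathcomp Require Import zify reals boolp classical_sets mpoly.

Set Implicit Arguments.
Unset Strict Implicit.
Unset Printing Implicit Defensive.

Import Order.TTheory GRing.Theory Num.Theory.
Local Open Scope ring_scope.

(** * Integral multiples of rational matrices, and generic rank *)

Lemma rat_mx_clear_denominators (p q : nat) (M : 'M[rat]_(p, q)) :
  exists2 D : int, D != 0 & exists N : 'M[int]_(p, q),
    D%:~R *: M = map_mx intr N.
Proof.
pose den (ij : 'I_p * 'I_q) := denq (M ij.1 ij.2).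
exists (\prod_ij den ij); first by apply/prodf_neq0 => ij _; exact: denq_neq0.
exists (\matrix_(i, j) (numq (M i j) * \prod_(ij | ij != (i, j)) den ij)).
apply/matrixP => i j; rewrite !mxE (bigD1 (i, j)) //= !rmorphM /= numqE.
by rewrite /den /= mulrAC [X in X * _ = _]mulrC.
Qed.

(** Row reduction of the left block leaves [r] rows that are independent there, whose images [Y] can
    prescribe, and [s - r] rows that vanish there, whose right parts are independent because [G] is
    row free. Since [s <= n], a complement of the span of these right parts has dimension at least
    [r], so it has room for the prescribed images. *)
Lemma row_free_generic (F : fieldType) (s m n : nat) (G : 'M[F]_(s, m + n)) :
  (s <= n)%N -> row_free G ->
  exists Y : 'M[F]_(m, n), row_free (G *m col_mx Y 1%:M).
Proof.
move=> le_sn freeG; pose r := \rank (lsubmx G).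
have le_rs : (r <= s)%N := rank_leq_row _.
have le_rm : (r <= m)%N := rank_leq_col _.
pose E := invmx (col_ebase (lsubmx G)).
have uE : E \in unitmx by rewrite unitmx_inv col_ebase_unit.
have lG : E *m lsubmx G = pid_mx r *m row_ebase (lsubmx G).
  rewrite /r; move: (mulmx_ebase (lsubmx G)) => /(congr1 (mulmx E)) <-.
  by rewrite -!mulmxA mulKmx ?col_ebase_unit.
pose G2 := E *m rsubmx G.
have EG : E *m G = row_mx (pid_mx r *m row_ebase (lsubmx G)) G2.
  by rewrite -{1}[G]hsubmxK mul_mx_row lG.
pose T := copid_mx r *m G2.
have coEG : copid_mx r *m (E *m G) = row_mx 0 T.
  by rewrite EG mul_mx_row mulmxA mul_copid_mx_pid // mul0mx.
have injEG : forall u : 'rV_s, u *m (E *m G) = 0 -> u = 0.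
  move=> u; rewrite mulmxA => /eqP; rewrite mulmx_free_eq0 // => /eqP uE0.
  by rewrite -[u](mulmxK uE) uE0 mul0mx.
have rT : \rank T = (s - r)%N.
  rewrite -(rank_row_0mx m) -coEG.
  by rewrite mulmxA !mxrankMfree ?row_free_unit // rank_copid_mx.
(* The first [r] rows are free to be prescribed: send them into a complement
   of the span of the other ones. *)
pose S : 'M_(s, n) := pid_mx r *m row_base (T^C)%MS.
have le_rk : (r <= \rank (T^C)%MS)%N.
  by rewrite mxrank_compl rT leq_subRL ?(leq_trans (leq_subr _ _)) // subnK.
pose Z := T + S.
have freeZ : row_free Z.
  apply: inj_row_free => u; rewrite mulmxDr => uZ0.
  have uTS : u *m T = - (u *m S) by apply/eqP; rewrite -addr_eq0 uZ0.
  have uT0 : u *m T = 0.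
    have : (u *m T <= T :&: T^C)%MS.
      rewrite sub_capmx submxMl uTS eqmx_opp mulmxA.
      by rewrite (submx_trans (submxMl _ _)) ?eq_row_base.
    by rewrite capmx_compl submx0 => /eqP.
  have uS0 : u *m S = 0 by apply/eqP; rewrite -oppr_eq0 -uTS uT0.
  have up0 : u *m pid_mx r = 0 :> 'rV_s.
    have /eqP : u *m pid_mx r *m row_base (T^C)%MS = 0 by rewrite -mulmxA.
    rewrite mulmx_free_eq0 ?row_base_free // => /eqP up.
    have <- : (pid_mx r : 'M_(s, \rank (T^C)%MS)) *m pid_mx r = pid_mx r :> 'M[F]_s.
      by rewrite pid_mx_id.
    by rewrite mulmxA up mul0mx.
  have uc0 : u *m copid_mx r = 0.
    by apply: injEG; rewrite -mulmxA coEG mul_mx_row uT0 mulmx0 row_mx0.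
  by rewrite -[u]mulmx1 -(subrK (pid_mx r) 1%:M) mulmxDr uc0 up0 addr0.
(* This witness solves [E *m G *m col_mx Y 1%:M = Z]: the factor [row_ebase] cancels, the first [r]
   rows are corrected by [Z - G2], and in the remaining rows [Z] and [G2] already agree. *)
exists (invmx (row_ebase (lsubmx G)) *m (pid_mx r *m (Z - G2))).
rewrite -row_leq_rank -(mxrankMfree _ (B := 1%:M)) ?row_free_unit ?unitmx1 //.
rewrite mulmx1 -(eqmxMfull _ (A := E)) ?row_full_unit // mulmxA EG.
rewrite mul_row_col mulmx1 -mulmxA mulKVmx ?row_ebase_unit //.
rewrite mulmxA pid_mx_id //.
suff -> : pid_mx r *m (Z - G2) + G2 = Z by rewrite row_leq_rank.
have cZ : copid_mx r *m Z = copid_mx r *m G2.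
  have cS : copid_mx r *m S = 0 by rewrite mulmxA mul_copid_mx_pid // mul0mx.
  by rewrite mulmxDr cS addr0 mulmxA copid_mx_id.
have pE : pid_mx r = 1%:M - copid_mx r :> 'M[F]_s.
  by rewrite opprB addrC subrK.
by rewrite pE mulmxBl mul1mx mulmxBr cZ subrr subr0 subrK.
Qed.

(** * Degree bounds for sums, products and determinants *)

Section MsizeBounds.
Variable N : nat.
Implicit Types p q : {mpoly int[N]}.

Lemma msize_sum_le (I : finType) (P : pred I) (F : I -> {mpoly int[N]}) (d : nat) :
  (forall i, P i -> (msize (F i) <= d)%N) -> (msize (\sum_(i | P i) F i)%R <= d)%N.
Proof.
move=> hF; elim/big_ind: _ => // [|p q hp hq]; first by rewrite mmeasure0.
by rewrite (leq_trans (mmeasureD_le _ _ _)) // geq_max hp.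
Qed.

(** As [msize] is the degree plus one, and 0 for the zero polynomial, bounds of the form [d.+1] let
    degrees add and cover zero factors as well. *)
Lemma msizeM_leS p q (a b : nat) :
  (msize p <= a.+1 -> msize q <= b.+1 -> msize (p * q)%R <= (a + b).+1)%N.
Proof.
have [->|p0] := eqVneq p 0; first by rewrite mul0r mmeasure0.
have [->|q0] := eqVneq q 0; first by rewrite mulr0 mmeasure0.
move=> hp hq; rewrite msizeM // -subn1 leq_subLR add1n.
by rewrite -addSn -addnS leq_add.
Qed.

(** Each term of the Leibniz expansion takes exactly one entry from every row. *)
Lemma msize_det_le (s : nat) (M : 'M[{mpoly int[N]}]_s) (d : 'I_s -> nat) :
  (forall i j, (msize (M i j) <= (d i).+1)%N) ->
  (msize (\det M) <= (\sum_i d i).+1)%N.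
Proof.
move=> hM; apply: msize_sum_le => u _; rewrite -[X in X.+1]add0n.
apply: msizeM_leS.
  by rewrite -signr_odd; case: odd; rewrite ?expr1 ?expr0 ?mmeasureN mmeasure1.
elim/big_rec2: _ => [|i a p _ IH]; first by rewrite mmeasure1.
exact: msizeM_leS.
Qed.

End MsizeBounds.

(** * The determinant as a polynomial in the entries of the matrix *)

(** Indexed in transposed form, so that the substitution in [algebraic_relation] turns it into
    [Theta^T]. *)
Definition generic_mx (m n : nat) : 'M[{mpoly int[n * m]}]_(m, n) :=
  \matrix_(k, j) 'X_(mxvec_index j k).

Definition generic_det (s m n : nat) (A : 'M[int]_(s, m + n)) (P : 'M[int]_(n, s)) :
    {mpoly int[n * m]} :=
  \det (map_mx (@mpolyC (n * m) int) A *m col_mx (generic_mx m n) 1%:M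
        *m map_mx (@mpolyC (n * m) int) P).

(** The ring [S] is left general because two specializations are needed: a rational one shows that
    the polynomial is nonzero, a real one that it vanishes at [Theta]. *)
Lemma mmap_generic_det (S : comNzRingType) (s m n : nat) (A : 'M[int]_(s, m + n))
    (P : 'M[int]_(n, s)) (X : 'M[S]_(n, m)) :
  mmap intr (fun k => mxvec X 0 k) (generic_det A P) =
  \det (map_mx intr A *m col_mx X^T 1%:M *m map_mx intr P).
Proof.
have mapC (a b : nat) (Q : 'M[int]_(a, b)) :
    map_mx (mmap (intr : int -> S) (fun k => mxvec X 0 k)) (map_mx (@mpolyC (n * m) int) Q)
    = map_mx intr Q.
  by apply/matrixP => i j; rewrite !mxE mmapC.
rewrite -det_map_mx !map_mxM !mapC map_col_mx map_mx1; congr (\det (_ *m col_mx _ _ *m _)).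
by apply/matrixP => k j; rewrite /generic_mx !mxE /= mmapX mmap1U mxvecE.
Qed.

(** A row of [A] with zero left block contributes a constant row, any other a row of degree at most
    one. Row [i] thus has degree at most [(i < r)], read as 0 or 1, and these bounds add up to
    [minn r s]. *)
Lemma msize_generic_det (s m n r : nat) (A : 'M[int]_(s, m + n)) (P : 'M[int]_(n, s)) :
  (forall (i : 'I_s) (k : 'I_m), (r <= i)%N -> lsubmx A i k = 0) ->
  (msize (generic_det A P) <= (minn r s).+1)%N.
Proof.
move=> A0.
have -> : minn r s = (\sum_(i < s) (i < r))%N.
  elim: s {A P A0} => [|s IHs]; first by rewrite big_ord0 minn0.
  rewrite big_ord_recr -IHs /=; lia.
apply: msize_det_le => i l; rewrite mxE; apply: msize_sum_le => j _.
rewrite -[X in X.+1]addn0; apply: msizeM_leS; last first.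
  by rewrite mxE mmeasureC; case: eqP.
rewrite -[A]hsubmxK map_row_mx mul_row_col mulmx1 mxE.
rewrite (leq_trans (mmeasureD_le _ _ _)) // geq_max; apply/andP; split; last first.
  by rewrite mxE mmeasureC (leq_trans (leq_b1 _)).
rewrite mxE; apply: msize_sum_le => k _; rewrite /generic_mx !mxE.
have [ir|ri] := ltnP i r; last first.
  by have := A0 i k ri; rewrite mxE => ->; rewrite mpolyC0 mul0r mmeasure0.
rewrite -[(true : nat)]add0n; apply: msizeM_leS; first by rewrite mmeasureC; case: eqP.
by rewrite mmeasureX /= mdeg1.
Qed.

(** Elimination on the left block takes place over the rationals, so that clearing denominators
    makes the coefficients of the determinant integers. *)
Lemma algebraic_relation_of_rows (R : realType) (m n s : nat) (Theta : 'M[R]_(n, m))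
    (B : 'M[int]_(s, m + n)) :
  (s <= n)%N -> row_free (map_mx intr B : 'M[R]_(s, m + n)) ->
  (\rank (map_mx intr B *m col_mx Theta^T 1%:M : 'M[R]_(s, n)) < s)%N ->
  algebraic_relation Theta (minn m s).
Proof.
move=> le_sn freeB ltBs; pose BQ : 'M[rat]_(s, m + n) := map_mx intr B.
have BR : map_mx ratr BQ = map_mx intr B :> 'M[R]_(s, m + n).
  by apply/matrixP => i j; rewrite !mxE /= ratr_int.
have freeBQ : row_free BQ by rewrite -(row_free_map (@ratr R)) BR.
pose E := invmx (col_ebase (lsubmx BQ)).
have uE : E \in unitmx by rewrite unitmx_inv col_ebase_unit.
have lG : lsubmx (E *m BQ) = pid_mx (\rank (lsubmx BQ)) *m row_ebase (lsubmx BQ).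
  rewrite -[BQ in LHS]hsubmxK mul_mx_row row_mxKl.
  move: (mulmx_ebase (lsubmx BQ)) => /(congr1 (mulmx E)) <-.
  by rewrite -!mulmxA mulKmx ?col_ebase_unit.
have freeG : row_free (E *m BQ).
  by rewrite -row_leq_rank mxrankMfree // mxrank_unit.
have [Y freeY] := row_free_generic le_sn freeG.
have [D D0 [A AE]] := rat_mx_clear_denominators (E *m BQ).
(* [P] is a multiple of a right inverse of the value at [Y]; hence at [Y] the determinant is a power
   of [D * D'], which is nonzero. *)
have [D' D'0 [P PE]] := rat_mx_clear_denominators (pinvmx (E *m BQ *m col_mx Y 1%:M)).
exists (generic_det A P); split.
- apply/eqP => /(congr1 (mmap (intr : int -> rat) (fun k => mxvec Y^T 0 k))).
  rewrite mmap_generic_det mmap0 trmxK -AE -PE -!scalemxAl -scalemxAr mulmxVp //.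
  rewrite scalerA detZ det1 mulr1 => /eqP.
  by rewrite expf_eq0 mulf_eq0 !intr_eq0 (negPf D0) (negPf D'0) andbF.
- apply: leq_trans (_ : (minn (\rank (lsubmx BQ)) s).+1 <= _)%N; last first.
    by rewrite ltnS leq_min geq_minr (leq_trans (geq_minl _ _)) // rank_leq_col.
  apply: msize_generic_det => i k ri; apply/eqP; rewrite -(intr_eq0 rat).
  have -> : (lsubmx A i k)%:~R = D%:~R * lsubmx (E *m BQ) i k.
    by have /matrixP/(_ i (lshift n k)) := AE; rewrite !mxE => <-.
  rewrite lG mulf_eq0 mxE big1 ?eqxx ?orbT // => j _.
  by rewrite mxE ltnNge ri andbF mul0r.
(* A nonzero determinant would force rank [s], but the rows of [A] are real combinations of those of
   [B], so the rank is at most the one bounded in [ltBs]. *)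
rewrite mmap_generic_det; apply/eqP; rewrite -[_ == 0]negbK -unitfE -unitmxE.
rewrite -row_free_unit -row_leq_rank -ltnNge.
apply: leq_ltn_trans (mxrankM_maxl _ _) _; apply: leq_ltn_trans ltBs.
have -> : map_mx intr A = map_mx ratr (D%:~R *: E) *m map_mx intr B :> 'M[R]_(s, m + n).
  rewrite -BR -map_mxM -scalemxAl AE.
  by apply/matrixP => i j; rewrite !mxE /= ratr_int.
by rewrite -mulmxA mxrankM_maxr.
Qed.

(** * Nearest integers, and existence of [pi_space] *)

(** Every integer is at least as far from [t] as the floor of [t] or its successor, so the infimum
    is attained at one of these two. The integer is added rather than subtracted to match the
    coordinates [y] of extended vectors; the crude bound 1 suffices for boundedness. *)
Lemma dist_intP (R : realType) (t : R) :
  exists k : int, dist_int t = `|t + k%:~R| /\ `|t + k%:~R| <= 1.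
Proof.
have attained (k : int) : (forall l : int, `|t - k%:~R| <= `|t - l%:~R|) ->
    dist_int t = `|t - k%:~R|.
  move=> kmin; apply/eqP; rewrite eq_le; apply/andP; split.
    apply: ge_inf; last by exists k.
    by exists 0 => _ [l _ <-].
  by apply: lb_le_inf; [exists `|t - k%:~R|; exists k | move=> _ [l _ <-]].
pose f := Num.floor t.
have f_le : f%:~R <= t by exact: floor_le.
have lt_f : t < f%:~R + 1 by rewrite -[1]/(1%:~R) -intrD; case/andP: (floor_itv t).
have far (l : int) : `|t - l%:~R| >= t - f%:~R \/ `|t - l%:~R| >= f%:~R + 1 - t.
  have [lf|fl] := lerP l f.
    left; rewrite ger0_norm; first by rewrite lerD2l lerN2 ler_int.
    by rewrite subr_ge0 (le_trans _ f_le) ?ler_int.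
  right; have fl1 : f%:~R + 1 <= l%:~R :> R by rewrite -[1]/(1%:~R) -intrD ler_int lezD1.
  by rewrite distrC ler_normr lerD2r fl1.
have n1 : `|t - f%:~R| = t - f%:~R by rewrite ger0_norm ?subr_ge0.
have n2 : `|t - (f + 1)%:~R| = f%:~R + 1 - t.
  by rewrite distrC ger0_norm intrD ?subr_ge0 ?ltW.
have [h|h] := lerP (t - f%:~R) (f%:~R + 1 - t).
  exists (- f); rewrite rmorphN /= (attained f) ?n1.
    by split=> //; rewrite lerBlDl ltW.
  by move=> l; case: (far l) => // ; exact: le_trans.
exists (- (f + 1)); rewrite rmorphN /= (attained (f + 1)) ?n2.
  by split=> //; rewrite lerBlDr addrC lerD2l.
by move=> l; case: (far l) => // ; apply: le_trans; exact: ltW.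
Qed.

Lemma extended_seq_exists (R : realType) (m n : nat) (Theta : 'M[R]_(n, m)) :
  proper_matrix Theta -> exists z, extended_seq Theta z.
Proof.
case=> x [xseq _].
have [y yP] := choice (fun nuj : nat * 'I_n => dist_intP (lform Theta nuj.2 (x nuj.1))).
exists (fun nu => row_mx (x nu) (\row_j y (nu, j))); split=> [|nu j].
  by under [X in best_approx_seq _ X]funext do rewrite row_mxKl.
by rewrite row_mxKl row_mxKr mxE; case: (yP (nu, j)) => ->.
Qed.

(** The default values of both [xget] are excluded here: the full integer lattice is admissible, so
    the set of dimensions is nonempty and has a least element. *)
Lemma tail_span_pi_space (R : realType) (m n : nat) (Theta : 'M[R]_(n, m)) :
  proper_matrix Theta ->
  tail_span Theta (pi_space Theta) /\ \dim (pi_space Theta) = Rdim Theta.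
Proof.
move=> /extended_seq_exists [z zE].
have full_closed : zmod_closed (predT : {pred 'rV[int]_(m + n)}) by [].
pose fullM := GRing.isZmodClosed.Build _ _ full_closed.
pose full : zmodClosed 'rV[int]_(m + n) := HB.pack (predT : {pred 'rV[int]_(m + n)}) fullM.
have spanF : tail_span Theta fullv.
  exists full; split; first by exists z; split=> //; exists 0%N.
  split=> [v _|W WP]; first exact: memvf.
  apply/subvP => v _; rewrite [v]row_sum_delta memv_suml // => i _.
  have := WP (delta_mx 0 i) isT; rewrite map_delta_mx /= => h; exact: memvZ.
pose dims r := `[< exists V, tail_span Theta V /\ \dim V = r >].
have dimsP : exists r, dims r by exists (\dim {:'rV[R]_(m + n)}); apply/asboolP; exists fullv.
have [V [Vspan Vdim]] : exists V, tail_span Theta V /\ \dim V = Rdim Theta.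
  have := @xgetPex _ 0%N [set r : nat | (exists V, tail_span Theta V /\ \dim V = r) /\
    (forall V, tail_span Theta V -> (r <= \dim V)%N)]%classic.
  case=> //; case: (ex_minnP dimsP) => r /asboolP hr rmin.
  exists r; split=> // V VP; apply: rmin; apply/asboolP; by exists V.
by have := @xgetPex _ 0%VS [set V | tail_span Theta V /\ \dim V = Rdim Theta]%classic;
  apply; exists V.
Qed.

(** * Independent integer vectors in a subspace, and partial inverses *)

Section RowsInSubspace.
Variables (F : fieldType) (p q : nat) (A : 'M[F]_(p, q)).

Lemma free_rows : row_free A -> free [tuple row i A | i < p].
Proof.
move=> freeA; apply/freeP => k k0 i.
have /eqP : \row_i k i *m A = 0.
  rewrite mulmx_sum_row -[RHS]k0; apply: eq_bigr => j _.
  by rewrite -tnth_nth tnth_mktuple mxE.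
by rewrite mulmx_free_eq0 // => /eqP/rowP/(_ i); rewrite !mxE.
Qed.

Lemma row_free_le_dim (W : {vspace 'rV[F]_q}) :
  row_free A -> (forall i, row i A \in W) -> (p <= \dim W)%N.
Proof.
move=> /free_rows/eqP; rewrite size_tuple => dimA AW; rewrite -[leqLHS]dimA.
by apply/dimvS/span_subvP => v /tnthP[i ->]; rewrite tnth_mktuple.
Qed.
End RowsInSubspace.

Lemma mulmx_memv (F : fieldType) (p q r : nat) (A : 'M[F]_(p, q)) (W : {vspace 'rV[F]_q})
    (B : 'M[F]_(r, p)) :
  (forall i, row i A \in W) -> forall i, row i (B *m A) \in W.
Proof. by move=> AW i; rewrite row_mul mulmx_sum_row memv_suml // => j _; exact: memvZ. Qed.

Lemma rank_le_dim (F : fieldType) (p q : nat) (A : 'M[F]_(p, q)) (W : {vspace 'rV[F]_q}) :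
  (forall i, row i A \in W) -> (\rank A <= \dim W)%N.
Proof.
move=> AW; apply: (row_free_le_dim (row_base_free A)).
have /submxP[B ->] : (row_base A <= A)%MS by rewrite eq_row_base.
exact: mulmx_memv.
Qed.

(** Vectors of [Lambda] are added one at a time: if all of them lay in the span [W] of the [k] rows
    found so far, minimality of [V] would give [V <= W], against [k < \dim V]. *)
Lemma span_integral_rows (R : realType) (N : nat) (Lambda : zmodClosed 'rV[int]_N)
    (V : {vspace 'rV[R]_N}) (k : nat) :
  is_span Lambda V -> (k <= \dim V)%N ->
  exists B : 'M[int]_(k, N),
    row_free (map_mx intr B : 'M[R]_(k, N)) /\ forall i, row i (map_mx intr B) \in V.
Proof.
case=> LV Vmin; elim: k => [|k IHk] ltk.
  by exists 0; split=> [|[]//]; rewrite -row_leq_rank.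
have [B [freeB BV]] := IHk (ltnW ltk).
pose W := <<[tuple row i (map_mx intr B : 'M[R]_(k, N)) | i < k]>>%VS.
have dimW : \dim W = k by have /eqP := free_rows freeB; rewrite size_tuple.
have [v vL vW] : exists2 v, v \in Lambda & (map_mx intr v : 'rV[R]_N) \notin W.
  apply: contrapT => noV; have /dimvS : (V <= W)%VS; last by rewrite dimW leqNgt ltk.
  by apply: Vmin => v vL; apply/negP => /negP vW; apply: noV; exists v.
rewrite -[k.+1]/(1 + k)%N; exists (col_mx v B); rewrite map_col_mx; split; last first.
  move=> i; rewrite -[i]splitK; case: split => j /=; rewrite ?rowKu ?rowKd //.
  by rewrite [row _ _]row_id //; exact: LV.
apply: inj_row_free => u; rewrite -[u]hsubmxK mul_row_col.
rewrite [lsubmx u]mx11_scalar mul_scalar_mx.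
set a := lsubmx u 0 0; have [->|a0] := eqVneq a 0.
  rewrite scale0r add0r => /eqP; rewrite mulmx_free_eq0 // => /eqP ->.
  by rewrite raddf0 row_mx0.
move=> /eqP; rewrite addr_eq0 => /eqP avE; case/negP: vW.
rewrite -[map_mx _ _](scalerK a0) avE memvZ // memvN -[_ *m _](row_id 0).
apply: mulmx_memv => i; rewrite memv_span //; apply/tnthP; exists i.
by rewrite tnth_mktuple.
Qed.

(** The restriction of [f] to [V], taken on the space [subvs_of V], is injective. A left inverse
    that is linear on the whole target allows [v] to be bounded in terms of the coordinates of
    [f v]. *)
Lemma lker0_on_inv (F : fieldType) (aT rT : vectType F) (f : 'Hom(aT, rT))
    (V : {vspace aT}) :
  (V :&: lker f)%VS = 0%VS -> exists g : 'Hom(rT, aT), {in V, cancel f g}.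
Proof.
move=> Vf0; pose h := (f \o linfun (vsval : subvs_of V -> aT))%VF.
have kerh : lker h == 0%VS.
  apply/lker0P => u v; rewrite !lfunE /= !lfunE /= => fuv.
  apply/val_inj/eqP; rewrite -subr_eq0 -memv0 -Vf0 memv_cap memvB ?subvsP //=.
  by rewrite memv_ker linearB /= fuv subrr.
exists (linfun (vsval : subvs_of V -> aT) \o h^-1)%VF => v vV.
have -> : f v = h (vsproj V v) by rewrite comp_lfunE lfunE /= vsprojK.
by rewrite comp_lfunE lker0_lfunK // lfunE /= vsprojK.
Qed.

(** * Positivity of [Kdim] and the rank bound at [Theta] *)

Lemma lform_mulmx (R : realType) (m n : nat) (Theta : 'M[R]_(n, m))
    (z : 'rV[int]_(m + n)) (j : 'I_n) :
  (map_mx intr z *m col_mx Theta^T 1%:M) 0 j =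
  lform Theta j (lsubmx z) + (rsubmx z 0 j)%:~R.
Proof.
rewrite -{1}[z]hsubmxK map_row_mx mul_row_col mulmx1 !mxE; congr (_ + _).
by apply: eq_bigr => i _; rewrite !mxE mulrC.
Qed.

Lemma leq_Mnorm (R : realType) (m n : nat) (Theta : 'M[R]_(n, m)) x :
  best_approx_seq Theta x -> forall nu, (nu <= Mnorm (x nu))%N.
Proof. by case=> _ Minc _ _; elim=> // nu /leq_ltn_trans; apply. Qed.

Lemma Kdim_gt0 (R : realType) (m n : nat) (Theta : 'M[R]_(n, m)) :
  proper_matrix Theta -> (0 < Kdim Theta)%N.
Proof.
move=> /tail_span_pi_space[[Lambda [[z [[xseq zdist] [nu0 zL]]] [LV _]]] _].
rewrite lt0n; apply/negP; rewrite dimv_eq0 => /eqP/lker0_on_inv[g gK].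
(* The sum of the absolute values of all matrix entries of [g]. It bounds every coordinate of [g w]
   as soon as the coordinates of [w] have absolute value at most 1, which holds for the images of
   the [z nu]. *)
pose c : R := \sum_(k < m + n) \sum_(j < n) `|g (delta_mx 0 j) 0 k|.
have bound nu : (nu0 <= nu)%N -> forall k, `|(z nu 0 k)%:~R| <= c.
  move=> le_nu k; have := gK _ (LV _ (zL _ le_nu)); rewrite lfunE /=.
  move=> /(congr1 (fun v : 'rV[R]_(m + n) => v 0 k)); rewrite [RHS]mxE => <-.
  rewrite [X in g X]row_sum_delta linear_sum summxE.
  apply: le_trans (ler_norm_sum _ _ _) _; rewrite /c (bigD1 k) //= -[X in X <= _]addr0.
  apply: lerD; last by rewrite !sumr_ge0 // => i _; rewrite sumr_ge0.
  apply: ler_sum => j _; rewrite linearZ mxE normrM ler_piMl // lform_mulmx zdist.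
  by have [l [-> ?]] := dist_intP (lform Theta j (lsubmx (z nu))).
have c0 : 0 <= c by rewrite !sumr_ge0 // => k _; rewrite sumr_ge0.
(* An index in the tail and strictly above the integer bound of [c]; the height at [nu] is at least
   [nu], yet at most that bound. *)
pose nu := maxn nu0 (Num.bound c).+1.
have := leq_Mnorm xseq nu; apply/negP; rewrite -ltnNge.
apply: leq_ltn_trans (_ : (Num.bound c < _)%N); last by rewrite leq_maxr.
apply/bigmax_leqP => i _; rewrite -(ler_nat R) mxE.
have /ltW := archi_boundP c0; apply: le_trans.
by rewrite natr_absz intr_norm; apply: bound; rewrite leq_maxl.
Qed.

(** Rank-nullity on [pi_space Theta]: the rows of the product lie in the image of this space, and
    [Kdim] is the dimension of the kernel of the restricted map. *)
Lemma rank_tail_rows (R : realType) (m n s : nat) (Theta : 'M[R]_(n, m))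
    (A : 'M[R]_(s, m + n)) :
  (forall i, row i A \in pi_space Theta) ->
  (\rank (A *m col_mx Theta^T 1%:M)%R <= \dim (pi_space Theta) - Kdim Theta)%N.
Proof.
move=> AV; rewrite /Kdim /Lspace; set f := linfun _.
rewrite -(limg_ker_dim f (pi_space Theta)) addKn; apply: rank_le_dim => i.
by rewrite row_mul; have := memv_img f (AV i); rewrite lfunE.
Qed.

Theorem theorem9 (R : realType) (m n : nat) (Theta : 'M[R]_(n, m))
    (hm : (0 < m)%N) (hn : (0 < n)%N) (hproper : proper_matrix Theta)
    (hR : (Rdim Theta <= n + Kdim Theta - 1)%N) :
  algebraic_relation Theta (minn m (Rdim Theta - Kdim Theta + 1)).
Proof.
have K0 := Kdim_gt0 hproper.
have [[Lambda [_ spanL]] dimR] := tail_span_pi_space hproper.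
(* With [0 < Kdim Theta <= Rdim Theta] the natural subtraction is exact and
   [Rdim Theta - Kdim Theta + 1] is at most [Rdim Theta], so enough independent rows exist; [hR]
   makes the same number at most [n]. *)
have leKR : (Kdim Theta <= Rdim Theta)%N by rewrite -dimR dimvS ?capvSl.
have [|B [freeB BV]] := @span_integral_rows _ _ _ _ (Rdim Theta - Kdim Theta + 1) spanL.
  by rewrite dimR; lia.
apply: (algebraic_relation_of_rows _ freeB); first by lia.
by apply: leq_ltn_trans (rank_tail_rows BV) _; rewrite dimR; lia.
Qed.
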